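(* Suppose that $\mu>\lambda\ge\theta>\kappa$ are infinite cardinals, and suppose that there is a family $\mathcal{P}$ of $\mu$ elements of $[\lambda]^{\le\kappa}$ such that every subfamily of $\mathcal{P}$ of size $<\theta$ has a transversal. Then there is such a family $\mathcal{P}$ (that is, a family of $\mu$ elements of $[\lambda]^{\le\kappa}$ every subfamily of which of size $<\theta$ has a transversal) such that in addition, every subfamily of $\mathcal{P}$ whose size $\sigma$ satisfies $\sigma<\theta$ and $\operatorname{cf}(\sigma)>\kappa$ has a subfamily of size $\operatorname{cf}(\sigma)$ that has a discretisation.
   Context: A transversal of a family of sets is a one-to-one choice function on it. A discretisation of a non-empty family $\mathcal{F}$ of non-empty sets is a choice function $f$ on $\mathcal{F}$ (i.e. $f(F)\in F$ for all $F\in\mathcal{F}$) such that for all $F_0\ne F_1$ in $\mathcal{F}$, $f(F_0)\notin F_1$. $[\lambda]^{\le\kappa}$ denotes the set of subsets of $\lambda$ of cardinality at most $\kappa$. *)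

(* Defs.v *)
From mathcomp Require Import all_boot.
From mathcomp Require Import boolp classical_sets functions cardinality.
From mathcomp Require wochoice.

Set Implicit Arguments.
Unset Strict Implicit.
Unset Printing Implicit Defensive.

Local Open Scope classical_set_scope.
Local Open Scope card_scope.

(* Cardinals are represented by types or sets, and compared up to
   equinumerosity with [#<=] and [#=]. *)

Definition card_lt T U (A : set T) (B : set U) : Prop :=
  A #<= B /\ ~ (B #<= A).
Notation "A '#<' B" := (card_lt A B)
  (at level 79, format "A  '#<'  B") : card_scope.

(* [R] orders [S] in the order type of the initial ordinal of cardinality
   [|S|]; well-orders of [wochoice] are reflexive. *)
Definition initial_well_order T (S : set T) (R : rel S) : Prop :=
  wochoice.well_order R /\
  forall x : S, [set y : S | R y x /\ y <> x] #< [set: S].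

Definition cofinal T (R : rel T) (D : set T) : Prop :=
  forall x, exists2 y, D y & R x y.

(* [is_cofinality S C] means |C| = cf(|S|): [C] has the least cardinality of a
   cofinal subset of the cardinal |S| viewed as an ordinal. Initial well-orders
   of [S] exist and are pairwise isomorphic, so the choice of [R] is
   immaterial. If [S] is finite this gives cf(0) = 0 and cf(n + 1) = 1. *)
Definition is_cofinality T U (S : set T) (C : set U) : Prop :=
  exists R : rel S,
    [/\ initial_well_order R,
        exists2 D : set S, cofinal R D & D #= C
      & forall D : set S, cofinal R D -> C #<= D].

Definition subsets_card_le (L K : Type) : set (set L) :=
  [set A | A #<= [set: K]].
Arguments subsets_card_le : clear implicits.

Definition choice_function T (F : set (set T)) (f : F -> T) : Prop :=
  forall A : F, val A (f A).

Definition transversal T (F : set (set T)) (f : F -> T) : Prop :=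
  choice_function f /\ injective f.

Definition has_transversal T (F : set (set T)) : Prop :=
  exists f : F -> T, transversal f.

(* The members of [F] are non-empty because [f] is a choice function. *)
Definition discretisation T (F : set (set T)) (f : F -> T) : Prop :=
  [/\ F !=set0, choice_function f
    & forall A0 A1 : F, A0 <> A1 -> ~ val A1 (f A0)].

Definition has_discretisation T (F : set (set T)) : Prop :=
  exists f : F -> T, discretisation f.

(* [P] is a family of |M| elements of [|L|]^(<= |K|) whose subfamilies of size
   < |Theta| all have transversals. *)
Definition small_transversal_family (M L Theta K : Type) (P : set (set L)) :
    Prop :=
  [/\ P `<=` subsets_card_le L K,
      P #= [set: M]
    & forall Q : set (set L),
        Q `<=` P -> Q #< [set: Theta] -> has_transversal Q].

(* Main.v *)
(* Fix injections j_A : A -> K for A in P and an injection h : L * K -> L, and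
   replace A by { h (a, j_A a) | a in A }. The map colouring h (a, k) by k is
   injective on every new set. If f is a transversal of Q, a point f(A)
   lying in B and having the same colour as f(B) is equal to f(B), so f is a
   discretisation of each colour class { A in Q | f(A) has colour k }. As there
   are only |K| < cf(|Q|) classes, one of them has at least cf(|Q|) elements. *)
Require Import Defs.
From mathcomp Require Import all_boot.
From mathcomp Require Import boolp classical_sets functions cardinality.

Local Open Scope classical_set_scope.
Local Open Scope card_scope.

(** * Injections and comparability of cardinals *)

Lemma card_le_injfun {T U} {A : set T} {B : set U} (u : U) : A #<= B ->
  exists2 f : T -> U, forall x, A x -> B (f x) & {in A &, injective f}.
Proof.
elim/Ppointed: U u B => [U u|U _ B]; first by have := no u.
by move=> /pcard_leP/injfunPex[f fAB finj]; exists f.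
Qed.

Lemma inj_in_card_le {T U} {A : set T} {B : set U} (f : T -> U) :
  {homo f : x / A x >-> B x} -> {in A &, injective f} -> A #<= B.
Proof.
move=> fAB finj; suff /injfunPex[g] : exists2 f, set_fun A B f & set_inj A f.
  exact: inj_card_le.
by exists f.
Qed.

(** A maximal [matching], obtained by Zorn's lemma, exhausts [A] or [B]: otherwise an unmatched
    point of each could be paired to enlarge it. *)
Lemma card_le_total {T U} (A : set T) (B : set U) : A #<= B \/ B #<= A.
Proof.
pose matching (G : set (T * U)) := G `<=` A `*` B /\
  forall p q, G p -> G q -> p.1 = q.1 <-> p.2 = q.2.
have [F FM Ftot|G [[GAB Ginj] Gmax]] := @Zorn_bigcup _ matching.
  split=> [p [X /FM[XAB _]]|p q [X FX Xp] [Y FY Yq]]; first exact: XAB.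
  have [XY|YX] := Ftot _ _ FX FY.
    by have [_] := FM _ FY; apply=> //; exact: XY.
  by have [_] := FM _ FX; apply=> //; exact: YX.
have [Acov|] := pselect (forall x, A x -> exists y, G (x, y)).
  (* If [U] is empty, then so is [A], whose points all have partners; otherwise [point] serves as
     the value outside [A]. *)
  left; elim/Ppointed: U => U in B matching G GAB Ginj Gmax Acov *.
    have /card_le0P : A #<= @set0 U; last by move=> ->; exact: card_ge0.
    apply/card_le0P; rewrite -subset0 => x /Acov[y _]; have := no y.
    by [].
  have [f fP] : {f : T -> U & forall x, A x -> G (x, f x)}.
    apply: (@choice _ _ (fun x y => A x -> G (x, y))) => x.
    have [/Acov[y Gxy]|nAx] := pselect (A x); last by exists point.
    by exists y.
  apply: (inj_in_card_le f) => [x /fP/GAB[]//|x y].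
  rewrite !inE => Ax Ay fxy.
  by have /Ginj/(_ (fP _ Ay)) /= [_] := fP _ Ax; apply.
move=> /existsNP[x /not_implyP[Ax nGx]].
have [Bcov|] := pselect (forall y, B y -> exists x, G (x, y)).
  have [f fP] : {f : U -> T & forall y, B y -> G (f y, y)}.
    apply: (@choice _ _ (fun y x => B y -> G (x, y))) => y.
    have [/Bcov[z Gzy]|nBy] := pselect (B y); last by exists x.
    by exists z.
  right; apply: (inj_in_card_le f) => [y /fP/GAB[]//|y z].
  rewrite !inE => By Bz fyz.
  by have /Ginj/(_ (fP _ Bz)) /= [+ _] := fP _ By; apply.
move=> /existsNP[y /not_implyP[By nGy]].
exfalso; apply: (Gmax (G `|` [set (x, y)])).
  split=> [|/(_ (x, y))]; first exact: subsetUl.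
  by apply: contra_not nGx => /(_ (or_intror erefl)); exists y.
split=> [p [/GAB//|->//]|p q [Gp|->] [Gq|->]] //=.
- exact: Ginj.
- by case: p Gp => a b Gab /=; split=> ?; subst;
    [case: nGx; exists b|case: nGy; exists a].
- by case: q Gq => a b Gab /=; split=> ?; subst;
    [case: nGx; exists b|case: nGy; exists a].
Qed.

(** * Squares of infinite sets *)

(** The domain of a pairing is a square, so its side can be read off the diagonal. *)
Definition graph_field {T} (G : set (T * T * T)) : set T :=
  [set x | exists z, G (x, x, z)].

(* [G] is the graph of an injection [X * X -> X], where [X = graph_field G]; this
   form is preserved by unions of chains. *)
Definition pairing_graph {T} (G : set (T * T * T)) : Prop :=
  [/\ forall p q, G p -> G q -> p.1 = q.1 <-> p.2 = q.2,
      forall x y, graph_field G x -> graph_field G y -> exists z, G (x, y, z)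
    & forall x y z, G (x, y, z) ->
        [/\ graph_field G x, graph_field G y & graph_field G z]].

(** Carries an injective operation on [D] over to [T]; this yields both the countable seed and the
    extension that contradicts maximality. *)
Lemma pairing_graph_image {I T} {D : set I} {e : I -> T} {phi : I * I -> I} :
  {in D &, injective e} -> {in D `*` D &, injective phi} ->
  (forall p, (D `*` D) p -> D (phi p)) ->
  let G := [set (e p.1, e p.2, e (phi p)) | p in D `*` D] in
  graph_field G = e @` D /\ pairing_graph G.
Proof.
move=> einj phiinj phiD G.
have GF : graph_field G = e @` D.
  apply/seteqP; split=> [x [z [[a b] [/= Da Db] [<- _ _]]]|_ [a Da <-]].
    by exists a.
  by exists (e (phi (a, a))), (a, a).
split=> //; split.
- move=> _ _ [[a b] Dab <-] [[a' b'] Dab' <-] /=.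
  case: (Dab) (Dab') => /= Da Db [/= Da' Db']; split.
    by move=> [/einj + /einj]; rewrite !inE => -> // ->.
  move=> /einj; rewrite !inE => /(_ (phiD _ Dab) (phiD _ Dab')).
  by move=> /phiinj; rewrite !inE => /(_ Dab Dab')[-> ->].
- rewrite GF => _ _ [a Da <-] [b Db <-].
  by exists (e (phi (a, b))), (a, b).
- rewrite GF => _ _ _ [[a b] Dab [<- <- <-]]; case: (Dab) => /= Da Db.
  by split; [exists a|exists b|exists (phi (a, b))] => //; exact: phiD.
Qed.

(** Each condition involves at most two triples, and any two members of a chain lie in a common
    member. *)
Lemma pairing_graph_bigcup {T} (F : set (set (T * T * T))) :
  F `<=` pairing_graph -> total_on F subset ->
  pairing_graph (\bigcup_(X in F) X).
Proof.
move=> Fpair Ftot.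
have common X Y : F X -> F Y -> exists Z, [/\ F Z, X `<=` Z & Y `<=` Z].
  by move=> FX FY; have [XY|YX] := Ftot _ _ FX FY; [exists Y|exists X]; split.
split.
- move=> p q [X FX Xp] [Y FY Yq]; have [Z [FZ XZ YZ]] := common _ _ FX FY.
  by have [+ _ _] := Fpair _ FZ; apply; [exact: XZ|exact: YZ].
- move=> x y [z [X FX Xz]] [t [Y FY Yt]].
  have [Z [FZ XZ YZ]] := common _ _ FX FY.
  have [_ /(_ x y) + _] := Fpair _ FZ.
  case; [by exists z; exact: XZ|by exists t; exact: YZ|].
  by move=> u Zu; exists u, Z.
- move=> x y z [X FX Xxyz]; have [_ _ /(_ _ _ _ Xxyz)] := Fpair _ FX.
  by case=> [[a ?] [b ?] [c ?]]; split; [exists a, X|exists b, X|exists c, X].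
Qed.

(** For a maximal pairing graph over a countable one, the field [X] is at least as large as its
    complement. Tagging points by bits then embeds [T] in [X], and the pairing on [X] does the
    rest. *)
Lemma infinite_square_card_le {T} :
  infinite_set [set: T] -> [set: T * T] #<= [set: T].
Proof.
move=> infT.
have [i iinj] : exists i : nat -> T, injective i.
  have [t _] := infinite_setN0 infT.
  have /(card_le_injfun t)[i _ iinj] := (infiniteP _).1 infT.
  by exists i => m n; apply: iinj; rewrite inE.
have [pr prinj] : exists pr : nat * nat -> nat, injective pr.
  have : [set: nat * nat] #<= [set: nat] by exact: countableP.
  move=> /(card_le_injfun 0)[pr _ prinj].
  by exists pr => p q; apply: prinj; rewrite inE.
(* A seed with countable field; it provides the maximal graph with two distinct points in its
   field. *)
pose G0 : set (T * T * T) :=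
  [set (i p.1, i p.2, i (pr p)) | p in setT `*` setT].
have [G0F G0pair] : graph_field G0 = range i /\ pairing_graph G0.
  apply: pairing_graph_image => //; first exact: in2W.
  exact: in2W.
(* [G !=set0 ->] accommodates the empty chain, whose union is empty. *)
have [F FP Ftot|G [[Gpair GG0] Gmax]] := @Zorn_bigcup _
    [set G : set (T * T * T) | pairing_graph G /\ (G !=set0 -> G0 `<=` G)].
  split; first by apply: pairing_graph_bigcup => // X /FP[].
  move=> [p [X FX Xp]]; apply: (subset_trans _ (bigcup_sup FX)).
  by have [_] := FP _ FX; apply; exists p.
have {}GG0 : G0 `<=` G.
  have [G_empty|/set0P/GG0//] := eqVneq G set0.
  exfalso; apply: (Gmax G0); last by split=> // _; exact: subset_refl.
  split; first by rewrite G_empty.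
  rewrite G_empty => /(_ (i 0, i 0, i (pr (0, 0)))); apply.
  by exists (0, 0).
have [GFun Gdom Grng] := Gpair.
pose X := graph_field G.
(* Two distinct points of [X], to serve as bits inside [X]. *)
have [c [cX cinj]] : exists c : bool -> T, (forall b, X (c b)) /\ injective c.
  exists (fun b : bool => i b); split=> [b|a b /iinj]; last by case: a; case: b.
  have [z G0z] : graph_field G0 (i b) by rewrite G0F; exists (nat_of_bool b).
  by exists z; exact: GG0.
have [f fP] : {f : T * T -> T &
    forall p, (X `*` X) p -> G (p, f p)}.
  apply: (@choice _ _ (fun p z => (X `*` X) p -> G (p, z))) => -[x y].
  have [[/= Xx Xy]|nXp] := pselect ((X `*` X) (x, y)).
    by have [z] := Gdom _ _ Xx Xy; exists z.
  by exists x.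
have fX x y : X x -> X y -> X (f (x, y)).
  by move=> Xx Xy; have /Grng[] := fP (x, y) (conj Xx Xy).
have finj x y x' y' : X x -> X y -> X x' -> X y' ->
    f (x, y) = f (x', y') -> x = x' /\ y = y'.
  move=> Xx Xy Xx' Xy' fxy.
  have [_ /(_ fxy)[-> ->]//] :=
    GFun _ _ (fP (x, y) (conj Xx Xy)) (fP (x', y') (conj Xx' Xy')).
(* Otherwise X has a disjoint copy h(X) and the pairing extends to X U h(X):
   pairs that are not in X * X are coded by their bits c and sent into h(X). *)
have {Gmax} XC : ~` X #<= X.
  have [//|XXC] := card_le_total (~` X) X; exfalso.
  have [h hXC hinj] : exists2 h : T -> T,
      (forall x, X x -> ~ X (h x)) & {in X &, injective h}.
    exact: (card_le_injfun (c true) XXC).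
  pose D : set (bool * T) := [set p | X p.2].
  pose e (p : bool * T) := if p.1 then h p.2 else p.2.
  pose phi (p : (bool * T) * (bool * T)) : bool * T :=
    if p.1.1 || p.2.1 then
      (true, f (f (c p.1.1, c p.2.1), f (p.1.2, p.2.2)))
    else (false, f (p.1.2, p.2.2)).
  have einj : {in D &, injective e}.
    move=> [[] x] [[] y]; rewrite !inE /D /e /= => Xx Xy exy //.
    - by rewrite (hinj x y) ?inE.
    - by case: (hXC _ Xx); rewrite exy.
    - by case: (hXC _ Xy); rewrite -exy.
    - by rewrite exy.
  have phiD p : (D `*` D) p -> D (phi p).
    move=> [/= Dx Dy]; rewrite /phi; case: ifP => _; rewrite /D /=.
      by apply: (fX); apply: fX.
    exact: fX.
  have phiinj : {in D `*` D &, injective phi}.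
    move=> [[a x] [a' x']] [[b y] [b' y']]; rewrite !inE /D /phi /=.
    move=> [/= Xx Xx'] [/= Xy Xy'].
    case: ifP => ha; case: ifP => hb [] //; last first.
      move=> /finj[]// -> ->.
      by move: a a' b b' ha hb => [] [] [] [].
    move=> /finj[|||| /finj[]// /cinj -> /cinj -> /finj[]// -> -> //];
      exact: fX.
  have [G1F G1pair] := pairing_graph_image einj phiinj phiD.
  set G1 := (X in graph_field X) in G1F G1pair.
  have GG1 : G `<=` G1.
    move=> [[x y] z] Gxyz; have [Xx Xy _] := Grng _ _ _ Gxyz.
    exists ((false, x), (false, y)); first by [].
    rewrite /e /phi /=; congr (_, _).
    by have [+ _] := GFun _ _ (fP (x, y) (conj Xx Xy)) Gxyz; apply.
  apply: (Gmax G1); last by split=> // _; exact: subset_trans GG1.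
  (* The extension is proper: [h (c true)] is in the field of [G1] but not in [X]. *)
  split=> // G1G; have X1 : graph_field G1 (h (c true)).
    by rewrite G1F; exists (true, c true) => //; exact: cX.
  have [z /G1G Gz] := X1; apply: (hXC (c true)) => //.
  by exists z.
(* Points of [X] are tagged with one bit; the others are first moved into [X] by [k] and tagged with
   the other bit. *)
have [s [sX sinj]] : exists s : T -> T, (forall x, X (s x)) /\ injective s.
  have [k kX kinj] : exists2 k : T -> T,
      (forall x, ~ X x -> X (k x)) & {in ~` X &, injective k}.
    exact: (card_le_injfun (c true) XC).
  exists (fun x => if `[< X x >] then f (c true, x) else f (c false, k x)).
  split=> [x|x y]; first by case: asboolP => Xx; apply: fX => //; exact: kX.
  case: asboolP => Xx; case: asboolP => Xy /finj[]//; try exact: kX.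
  - by move=> /cinj.
  - by move=> /cinj.
  - by move=> _ /kinj; rewrite !inE; apply.
apply: (inj_in_card_le (fun p => f (s p.1, s p.2))) => // -[x y] [x' y'] _ _ /=.
by move=> /finj[]// /sinj -> /sinj ->.
Qed.

(** * Transversals, cofinality and discretisations *)

(** Total functions on sets are easier to move between a family and its recoding than functions on a
    subtype; [t] is the value off [F]. *)
Lemma has_transversalP {T} {F : set (set T)} (t : T) :
  has_transversal F <->
  exists2 f : set T -> T, forall A, F A -> A (f A) & {in F &, injective f}.
Proof.
split=> [[f [fF finj]]|[f fF finj]].
  pose g A := if pselect (F A) is left FA then f (SigSub (mem_set FA)) else t.
  exists g => [A FA|A B]; rewrite /g.
    by case: pselect => // FA'; exact: (fF (SigSub (mem_set FA'))).
  rewrite !inE => FA FB; case: pselect => // ?; case: pselect => // ?.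
  by move=> /finj[].
exists (fun A => f (val A)); split=> [A|A B].
  by apply: fF; exact: set_valP.
by move=> fAB; apply: val_inj; exact: finj (valP A) (valP B) fAB.
Qed.

(* If no class is cofinal, strict upper bounds of the |K| < cf(|S|) classes form
   a non-cofinal set, and any strict upper bound of them escapes its own class. *)
Lemma cofinality_le_class {T U K} {S : set T} {C : set U} (c : S -> K) :
  is_cofinality S C -> [set: K] #< C -> exists k, C #<= c @^-1` [set k].
Proof.
move=> [R [[Rwo _] _ Cmin]] [_ nCK].
(* Totality comes from the minimum of each pair. *)
have Rtot : total R.
  move=> x y; have [|m [[/asboolP mxy mle] _]] :=
      Rwo [pred z | `[< z = x \/ z = y >]].
    by exists x; apply/asboolP; left.
  have mx : R m x by apply: mle; apply/asboolP; left.
  have my : R m y by apply: mle; apply/asboolP; right.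
  by case: mxy mx my => -> Rx Ry; apply/orP; [left|right].
have [[k Ck]|/forallNP nC] := pselect (exists k, cofinal R (c @^-1` [set k])).
  by exists k; exact: Cmin.
have [b bP] : {b : K -> S & forall k y, c y = k -> ~ R (b k) y}.
  apply: (@choice _ _ (fun k x => forall y, c y = k -> ~ R x y)) => k.
  have /existsNP[x xP] := nC k.
  by exists x => y cy Rxy; apply: xP; exists y.
exfalso; apply: nCK; apply: (@card_le_trans _ _ _ (range b)); last first.
  exact: card_image_le.
apply: Cmin => z; exists (b (c z)); first by exists (c z).
by have /orP[//|/bP] := Rtot z (b (c z)); case.
Qed.

Lemma has_discretisation_of_coloring {T K U} (c : T -> K) {Q : set (set T)}
    {C : set U} :
  (forall A, Q A -> {in A &, injective c}) -> has_transversal Q ->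
  is_cofinality Q C -> [set: K] #< C ->
  exists Q', [/\ Q' `<=` Q, Q' #= C & has_discretisation Q'].
Proof.
move=> cinj [f [fQ finj]] cofC ltKC.
(* The large colour class is cut down to a part [D] of exactly the size of [C]. *)
have [k /card_subP[D DC Dk]] := cofinality_le_class (c \o f) cofC ltKC.
have DQ : val @` D `<=` Q by exact: sub_setP.
have cardD : val @` D #= C.
  apply: card_eq_trans DC; apply: inj_card_eq; exact: in2W val_inj.
exists (val @` D); split=> //.
have [r rP] : {r : (val @` D) -> Q &
    forall A, val (r A) = val A /\ c (f (r A)) = k}.
  apply: (@choice _ _ (fun A B => val B = val A /\ c (f B) = k)) => A.
  by have [B DB BA] := set_valP A; exists B; split=> //; exact: Dk.
have rA A : val (r A) = val A by have [] := rP A.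
have rk A : c (f (r A)) = k by have [] := rP A.
exists (fun A => f (r A)); split.
(* Being larger than [K], [C] is not empty. *)
- apply/set0P/eqP => D0; apply: ltKC.2.
  by rewrite -(card_le_eql cardD) D0 card_ge0.
- by move=> A; rewrite /= -rA; exact: fQ.
move=> A B AB fAB; apply: AB; apply: val_inj; rewrite -!rA.
by congr val; apply: finj; apply: (cinj (val (r B)) (set_valP _));
  rewrite ?rk // inE; [rewrite rA|exact: fQ].
Qed.

(** * Recoding the family with coloured points *)

Theorem theorem4p4 (M L Theta K : Type)
  (infM : infinite_set [set: M]) (infL : infinite_set [set: L])
  (infTheta : infinite_set [set: Theta]) (infK : infinite_set [set: K])
  (ltLM : [set: L] #< [set: M])
  (leThetaL : [set: Theta] #<= [set: L])
  (ltKTheta : [set: K] #< [set: Theta])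
  (exP : exists P : set (set L), small_transversal_family M Theta K P) :
  exists P : set (set L),
    small_transversal_family M Theta K P /\
    forall Q : set (set L),
      Q `<=` P -> Q #< [set: Theta] ->
      forall C : set (set L),
        is_cofinality Q C -> [set: K] #< C ->
        exists Q' : set (set L),
          [/\ Q' `<=` Q, Q' #= C & has_discretisation Q'].
Proof.
have [l0 _] := infinite_setN0 infL; have [k0 _] := infinite_setN0 infK.
(* [K] embeds in [L] through [Theta], so [L * K] embeds in [L * L], hence in the infinite [L]. *)
have [h hinj] : exists h : L * K -> L, injective h.
  have : [set: L * K] #<= [set: L].
    apply: card_le_trans (infinite_square_card_le infL).
    have /(card_le_injfun l0)[i _ iinj] := card_le_trans ltKTheta.1 leThetaL.
    apply: (inj_in_card_le (fun p => (p.1, i p.2))) => // -[x k] [y l] _ _ /=.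
    by move=> [-> /iinj]; rewrite !inE => ->.
  move=> /(card_le_injfun l0)[h _ hinj].
  by exists h => p q; apply: hinj; rewrite inE.
have [g hK] : exists g, cancel h g.
  have [g gP] : {g : L -> L * K & forall l p, h p = l -> g l = p}.
    apply: (@choice _ _ (fun l q => forall p, h p = l -> q = p)) => l.
    have [[q <-]|nl] := pselect (exists q, h q = l).
      by exists q => p /hinj.
    by exists (l0, k0) => p hp; case: nl; exists p.
  by exists g => p; exact: gP.
have [P [PK PM Ptr]] := exP.
have [j jinj] : {j : set L -> L -> K &
    forall A, P A -> {in A &, injective (j A)}}.
  apply: (@choice _ _ (fun A f => P A -> {in A &, injective f})) => A.
  have [/PK /(card_le_injfun k0)[f _ finj]|nPA] := pselect (P A); last first.
    by exists (fun=> k0).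
  by exists f.
(* [decode] forgets the colours; as a left inverse it makes [code] injective, so the new family
   still has |M| members. *)
pose code A := (fun a => h (a, j A a)) @` A.
pose decode B := (fun l => (g l).1) @` B.
have codeK : cancel code decode.
  move=> A; rewrite /decode /code image_comp.
  by rewrite -[RHS]image_id; apply: eq_imagel => a _ /=; rewrite hK.
(* Decoding maps [Q] injectively to a subfamily of [P] of the same size; a transversal of that
   subfamily lifts through [h], the first coordinates keeping the lifted values distinct. *)
have code_tr (Q : set (set L)) :
    Q `<=` code @` P -> Q #< [set: Theta] -> has_transversal Q.
  move=> QP ltQ.
  have decodeQ B : Q B -> P (decode B) /\ code (decode B) = B.
    by move=> /QP[A PA <-]; rewrite codeK.
  have decode_inj : {in Q &, injective decode}.
    move=> A B; rewrite !inE => /decodeQ[_ {2}<-] /decodeQ[_ {2}<-].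
    by move=> ->.
  have cardQ : decode @` Q #= Q by exact: inj_card_eq.
  have /(has_transversalP l0)[f fQ finj] : has_transversal (decode @` Q).
    apply: Ptr => [_ [B /decodeQ[PB _] <-]//|].
    by split; rewrite ?(card_le_eql cardQ) ?(card_le_eqr cardQ); case: ltQ.
  apply/(has_transversalP l0).
  exists (fun B => h (f (decode B), j (decode B) (f (decode B)))) => [B QB|A B].
    have [_ BE] := decodeQ _ QB; rewrite -[X in X _]BE.
    by apply: imageP; apply: fQ; exists B.
  rewrite !inE => QA QB /hinj[/finj + _].
  rewrite !inE => /(_ (imageP _ QA) (imageP _ QB)).
  by apply: decode_inj; rewrite inE.
exists (code @` P); split.
  split=> //.
    move=> _ [A PA <-]; apply: card_le_trans (card_image_le _ _) _.
    exact: PK.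
  apply: card_eq_trans PM; apply: inj_card_eq.
  exact: in2W (can_inj codeK).
move=> Q QP ltQ C; apply: (has_discretisation_of_coloring (fun l => (g l).2)).
  (* On [code A] the colour determines the point because [j A] is injective on [A]. *)
  move=> _ /QP[A PA <-] x y; rewrite !inE => -[a Aa <-] [b Ab <-].
  by rewrite !hK /= => jab; rewrite (jinj A PA a b) ?inE.
exact: code_tr.
Qed.
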